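(* Let $G$ be an infinite Boolean topological group such that, for every countable subgroup $H$ of $G$, the subspace topology on $H$ induced by the topology of $G$ is finer than the Bohr topology of $H$. Then $G$ is not selectively pseudocompact.
   Context: All topological groups are assumed to be Hausdorff. A group $G$ is Boolean if $x^2=e$ for every $x\in G$, where $e$ is the identity element of $G$ (every Boolean group is abelian). ''Finer'' is meant in the non-strict sense (the topologies may coincide). The Bohr topology of an abelian group $H$ is the initial topology on $H$ with respect to the family of all (abstract) group homomorphisms from $H$ to the circle group $\mathbb{T}$; it is the maximal precompact group topology on $H$. A point $x$ of a topological space $X$ is an accumulation point of a sequence $\{x_n:n\in\mathbb{N}\}$ of points of $X$ if the set $\{n\in\mathbb{N}: x_n\in V\}$ is infinite for every neighbourhood $V$ of $x$ in $X$. A topological space $X$ is selectively pseudocompact if for every sequence $\{U_n:n\in\mathbb{N}\}$ of non-empty open subsets of $X$ one can choose $x_n\in U_n$ for every $n\in\mathbb{N}$ such that the sequence $\{x_n:n\in\mathbb{N}\}$ has an accumulation point in $X$. *)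

(* Defs.v *)
From HB Require Import structures.
From mathcomp Require Import all_boot all_order all_algebra.
From mathcomp Require Import complex.
From mathcomp Require Import all_classical all_reals topology normedtype.

Set Implicit Arguments.
Unset Strict Implicit.
Unset Printing Implicit Defensive.

Import Order.TTheory GRing.Theory Num.Theory.
Import numFieldNormedType.Exports.

Local Open Scope classical_set_scope.

(* The library only has abelian topological groups, written additively
   (topologicalZmodType); groups here are multiplicative and not assumed
   commutative. *)
HB.mixin Record isTopologicalGroup G & Topological G & Group G := {
  mulg_continuous : continuous (fun p : G * G => (p.1 * p.2)%g) ;
  invg_continuous : continuous (fun x : G => x^-1%g)
}.

#[short(type="topologicalGroupType")]
HB.structure Definition TopologicalGroup :=
  {G of Topological G & Group G & isTopologicalGroup G}.

Definition boolean_group (G : groupType) : Prop :=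
  forall x : G, (x ^+ 2 = 1)%g.

Section Circle.
Local Open Scope ring_scope.
Local Open Scope complex_scope.
Variable R : realType.

(* The norm of R[i] takes values in R[i] itself. *)
Record circle := Circle { circle_val : R[i]; _ : `|circle_val| == 1 }.

HB.instance Definition _ := [isSub for circle_val].
HB.instance Definition _ := [Choice of circle by <:].

Let circle1_subproof : `|1 : R[i]| == 1.
Proof. by rewrite normr1. Qed.

Let circleM_subproof (x y : circle) : `|val x * val y| == 1.
Proof. by rewrite normrM (eqP (valP x)) (eqP (valP y)) mulr1. Qed.

Let circleV_subproof (x : circle) : `|(val x)^-1| == 1.
Proof. by rewrite normfV (eqP (valP x)) invr1. Qed.

Definition circle_one : circle := Circle circle1_subproof.
Definition circle_mul (x y : circle) : circle := Circle (circleM_subproof x y).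
Definition circle_inv (x : circle) : circle := Circle (circleV_subproof x).

Let circle_mulA : associative circle_mul.
Proof. by move=> x y z; apply/val_inj; rewrite /= mulrA. Qed.

Let circle_mul1 : left_id circle_one circle_mul.
Proof. by move=> x; apply/val_inj; rewrite /= mul1r. Qed.

Let circle_mulr1 : right_id circle_one circle_mul.
Proof. by move=> x; apply/val_inj; rewrite /= mulr1. Qed.

Let circle_neq0 (x : circle) : val x != 0.
Proof. by rewrite -normr_eq0 (eqP (valP x)) oner_neq0. Qed.

Let circle_mulV : left_inverse circle_one circle_inv circle_mul.
Proof. by move=> x; apply/val_inj; rewrite /= mulVf ?circle_neq0. Qed.

Let circle_mulrV : right_inverse circle_one circle_inv circle_mul.
Proof. by move=> x; apply/val_inj; rewrite /= mulfV ?circle_neq0. Qed.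

HB.instance Definition _ := isGroup.Build circle
  circle_mulA circle_mul1 circle_mulr1 circle_mulV circle_mulrV.

(* The topology of R[i], given by its norm, is attached by the library to the
   alias R[i]^o. *)
HB.instance Definition _ := Topological.copy circle
  (initial_topology (val : circle -> R[i]^o)).

End Circle.

(* Abstract homomorphisms into the circle; a multiplicative map between groups
   preserves 1 and inverses. *)
Definition bohr_topology (R : realType) (H : groupType) : Type :=
  @sup_topology H {multiplicative H -> circle R}
    (fun chi => Topological.on (initial_topology (chi : H -> circle R))).

HB.instance Definition _ (R : realType) (H : groupType) :=
  Topological.on (bohr_topology R H).

Section Subgroup.
Variables (G : groupType) (H : groupClosed G).

Record subgroup_type :=
  SubgroupElt { subgroup_val : G; _ : subgroup_val \in H }.

HB.instance Definition _ := [isSub for subgroup_val].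
HB.instance Definition _ := [Choice of subgroup_type by <:].

Let subgroup_closed : group_closed [pred x : G | x \in H].
Proof. by split=> [|x y]; rewrite ?inE; [exact: gpred1|exact: gpredF]. Qed.

HB.instance Definition _ :=
  SubChoice_isSubGroup.Build G _ subgroup_type subgroup_closed.

End Subgroup.

HB.instance Definition _ (G : topologicalGroupType) (H : groupClosed G) :=
  Topological.copy (subgroup_type H)
    (initial_topology (val : subgroup_type H -> G)).

Definition finer_than_bohr (R : realType) (G : topologicalGroupType)
    (H : groupClosed G) : Prop :=
  @open (bohr_topology R (subgroup_type H)) `<=` @open (subgroup_type H).

Definition accumulation_point (X : topologicalType) (x : nat -> X) (a : X) :
    Prop :=
  forall V : set X, nbhs a V -> infinite_set [set n | V (x n)].

Definition selectively_pseudocompact (X : topologicalType) : Prop :=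
  forall U : nat -> set X, (forall n, open (U n) /\ U n !=set0) ->
    exists2 x : nat -> X, (forall n, U n (x n)) &
      exists a : X, accumulation_point x a.

(* Main.v *)
Require Import Defs.
From HB Require Import structures.
From mathcomp Require Import all_boot all_order all_algebra.
From mathcomp Require Import complex.
From mathcomp Require Import all_classical all_reals topology normedtype.

(** Written additively over F_2: in a non-discrete group one finds non-empty
    open sets U_n and a decreasing sequence of neighbourhoods V_n of 0 with
    U_n + V_(n+1) included in V_n minus {0}.  If x_n is in U_n for all n, then a
    finite sum of distinct terms x_i with i > n lies in V_(n+1), so it cannot
    cancel x_n: every selection from (U_n) is linearly independent.  A linearly
    independent sequence has no accumulation point a: on the countable span of
    the x_n and a, some character takes at x_n, for all but finitely many n, a
    value different from its value at a, and this character is continuous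
    because the topology of the span is finer than its Bohr topology. *)

Local Open Scope classical_set_scope.

(** * Open fibres in the Bohr topology *)

Lemma sup_topology_open (T : choiceType) (I : Type) (Tc : I -> Topological T)
    (i : I) (A : set T) :
  @open (Topological.Pack (Tc i)) A -> @open (sup_topology Tc) A.
Proof.
move=> Aop; rewrite openE => a Aa.
have /cvg_sup/(_ i) cvg_i := @cvg_id _ (nbhs (a : sup_topology Tc)).
by apply: cvg_i; apply: open_nbhs_nbhs.
Qed.

Section BohrOpen.
Local Open Scope ring_scope.
Import GRing.Theory Num.Theory numFieldNormedType.Exports.
Variable R : realType.

Let sign_subproof (b : bool) : `|(-1) ^+ b : R[i]%C| == 1.
Proof. by rewrite normr_sign. Qed.

Definition circle_sign (b : bool) : circle R := Circle (sign_subproof b).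

Lemma circle_signM : {morph circle_sign : b c / b (+) c >-> (b * c)%g}.
Proof. by move=> b c; apply/val_inj; rewrite /= signr_addb. Qed.

Lemma open_preimage_circle_sign (b : bool) :
  exists2 B : set (circle R), open B & forall c, B (circle_sign c) <-> c = b.
Proof.
(* Only two values have to be told apart, so the complement of the opposite sign suffices. *)
exists (val @^-1` ~` [set val (circle_sign (~~ b)) : R[i]%C^o]).
  exists (~` [set val (circle_sign (~~ b)) : R[i]%C^o]) => //.
  apply/closed_openC/accessible_closed_set1/hausdorff_accessible.
  exact: norm_hausdorff.
move=> c; rewrite /preimage /=; split=> [|->].
  by case: b c => -[] //=; case.
by apply/eqP; rewrite signrN -subr_eq0 opprK -mulr2n mulrn_eq0/= signr_eq0.
Qed.

Lemma bohr_open_fiber (H : groupType) (f : H -> bool) (b : bool) :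
  {morph f : x y / (x * y)%g >-> x (+) y} ->
  @open (bohr_topology R H) [set h | f h = b].
Proof.
move=> fM; have [B Bop BE] := open_preimage_circle_sign b.
pose chi := circle_sign \o f.
have chiM : {morph chi : x y / (x * y)%g}.
  by move=> x y; rewrite /chi /= fM circle_signM.
pose chiP : {multiplicative H -> circle R} :=
  HB.pack_for (Multiplicative.type H (circle R)) chi
    (isMultiplicative.Build H (circle R) chi chiM).
pose Tc (phi : {multiplicative H -> circle R}) :=
  Topological.on (initial_topology (phi : H -> circle R)).
suff : @open (Topological.Pack (Tc chiP)) [set h | f h = b].
  exact: (sup_topology_open H _ Tc).
by exists B => //; apply/seteqP; split=> h /BE.
Qed.

End BohrOpen.

(** * Linear combinations over F_2 *)

Section Words.
Local Open Scope group_scope.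
Context {G : groupType}.
Implicit Types (x : nat -> G) (e : seq bool).

Fixpoint word x e : G :=
  if e is b :: e' then x 0 ^+ b * word (x \o S) e' else 1.

(** Linear independence over F_2. Trailing [false] entries do not affect a word, so the zero
    combination has many lists. *)
Definition free x := forall e, word x e = 1 -> ~~ has id e.

Fixpoint xors e1 e2 : seq bool :=
  match e1, e2 with
  | [::], _ => e2
  | _, [::] => e1
  | b1 :: e1', b2 :: e2' => b1 (+) b2 :: xors e1' e2'
  end.

(** For free [x], this is the exponent of -1 in the value at [word x e] of the character sending
    each [x i] to (-1)^(c i). *)
Fixpoint dot (c : nat -> bool) e : bool :=
  if e is b :: e' then c 0 && b (+) dot (c \o S) e' else false.

Lemma dot_xors c e1 e2 : dot c (xors e1 e2) = dot c e1 (+) dot c e2.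
Proof.
elim: e1 e2 c => [|b1 e1 IH] [|b2 e2] c //=; first by rewrite addbF.
by rewrite IH andb_addr addbACA.
Qed.

Lemma dot_nhas c e : ~~ has id e -> dot c e = false.
Proof. by elim: e c => //= -[] e IH c //= /IH ->; rewrite andbF. Qed.

Lemma dot_pred0 e : dot xpred0 e = false.
Proof. by elim: e => [|b e] //= ->. Qed.

Lemma dot_pred1 i e : dot (pred1 i) e = nth false e i.
Proof.
elim: e i => [|b e IH] [|i] //=; last exact: IH.
by rewrite (dot_pred0 e) addbF.
Qed.

Definition unit_exp n : seq bool := rcons (nseq n false) true.

Lemma word_unit_exp x n : word x (unit_exp n) = x n.
Proof.
by elim: n x => [|n IH] x /=; rewrite ?expg1 ?mulg1// expg0 mul1g IH.
Qed.

Lemma dot_unit_exp c n : dot c (unit_exp n) = c n.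
Proof. by elim: n c => [|n IH] c /=; rewrite ?andbT ?addbF// andbF IH. Qed.

End Words.

(** * Spans in a Boolean group *)

Section Boolean.
Local Open Scope group_scope.
Context {G : groupType} (G_boolean : boolean_group G).
Implicit Types (x : nat -> G) (e : seq bool).

Lemma boolean_mulgg (g : G) : g * g = 1.
Proof. exact: G_boolean. Qed.

Lemma boolean_invg (g : G) : g^-1 = g.
Proof. by apply: (mulgI g); rewrite mulgV boolean_mulgg. Qed.

Lemma boolean_mulgC (g h : G) : g * h = h * g.
Proof. by rewrite -[LHS]boolean_invg invgM !boolean_invg. Qed.

Lemma boolean_expgD (g : G) (b c : bool) : g ^+ (b (+) c) = g ^+ b * g ^+ c.
Proof. by case: b c => -[]; rewrite ?expg0 ?expg1 ?mulg1 ?mul1g ?boolean_mulgg. Qed.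

Lemma word_xors x e1 e2 : word x (xors e1 e2) = word x e1 * word x e2.
Proof.
elim: e1 e2 x => [|b1 e1 IH] [|b2 e2] x /=; rewrite ?mulg1 ?mul1g//.
rewrite IH boolean_expgD -!mulgA; congr (_ * _); rewrite !mulgA.
by congr (_ * _); rewrite boolean_mulgC.
Qed.

(** The sum of two expansions of one element expands 1, so it is zero by freeness. Hence [dot c]
    descends to the span. *)
Lemma free_dot x c e1 e2 : free x -> word x e1 = word x e2 -> dot c e1 = dot c e2.
Proof.
move=> xfree e12; have /xfree/(dot_nhas c _) : word x (xors e1 e2) = 1.
  by rewrite word_xors e12 boolean_mulgg.
by rewrite dot_xors; case: (dot c e1) (dot c e2) => -[].
Qed.

Lemma span_groupClosed x :
  exists H : groupClosed G, forall g, g \in H <-> exists e, word x e = g.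
Proof.
pose S : {pred G} := fun g => `[< exists e, word x e = g >].
have SP g : g \in S <-> exists e, word x e = g by split=> /asboolP.
have SM : mulg_closed S.
  move=> _ _ /SP[e1 <-] /SP[e2 <-]; apply/SP.
  by exists (xors e1 e2); rewrite word_xors.
have S1 : 1 \in S by apply/SP; exists [::].
have SV : invg_closed S by move=> g; rewrite boolean_invg.
pose H : groupClosed G := HB.pack_for (GroupClosed.type G) S
  (isMulClosed.Build G S SM) (isMul1Closed.Build G S S1)
  (isInvClosed.Build G S SV).
by exists H.
Qed.

Lemma free_cons (a : G) x : free x -> (forall e, word x e <> a) ->
  free (fun n => if n is m.+1 then x m else a).
Proof.
move=> xfree xa [//|b e] /=.
rewrite (_ : _ \o S = x) //; case: b => /=; last by rewrite expg0 mul1g => /xfree.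
by rewrite expg1 => /(canRL (mulKg a)); rewrite mulg1 boolean_invg => /xa.
Qed.

End Boolean.

(** * Characters against accumulation points *)

Section FreeSequences.
Local Open Scope group_scope.
Variables (R : realType) (G : topologicalGroupType).
Hypothesis G_boolean : boolean_group G.
Hypothesis G_bohr : forall H : groupClosed G,
  countable [set x : G | x \in H] -> finer_than_bohr R H.
Implicit Types (x : nat -> G) (c : nat -> bool) (e : seq bool).

(** On the countable span, the fibre of the character given by [c] is Bohr open, hence the trace of
    an open set of [G]. *)
Lemma free_dot_near x c e : free x ->
  exists2 V : set G, nbhs (word x e) V &
    forall e', V (word x e') -> dot c e' = dot c e.
Proof.
move=> xfree; have [H HP] := span_groupClosed G_boolean x.
have Hcount : countable [set g : G | g \in H].
  rewrite (_ : mkset _ = range (word x)); last first.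
    apply/seteqP; split=> [g /HP[e' <-]|_ [e' _ <-]] /=; first by exists e'.
    by apply/HP; exists e'.
  exact: sub_countable (card_image_le _ _) (countableP _).
pose f (h : subgroup_type H) : bool :=
  `[< exists2 e', word x e' = val h & dot c e' >].
have fE h e' : word x e' = val h -> f h = dot c e'.
  move=> e'h; apply/asboolP/idP => [[e2]|]; last by exists e'.
  by rewrite -e'h => /(free_dot G_boolean x c _ _ xfree) ->.
have fM : {morph f : g h / g * h >-> g (+) h}.
  move=> g h.
  have [e1 e1g] := (HP _).1 (valP g); have [e2 e2h] := (HP _).1 (valP h).
  rewrite (fE _ _ e1g) (fE _ _ e2h) -dot_xors; apply: fE.
  by rewrite (word_xors G_boolean) e1g e2h.
have [V Vop VE] := G_bohr H Hcount _ (bohr_open_fiber R _ f (dot c e) fM).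
have wH e' : word x e' \in H by apply/HP; exists e'.
have VP e' : V (word x e') <-> dot c e' = dot c e.
  rewrite -(fE (SubgroupElt (wH e')) e' erefl).
  by have := congr1 (fun A => A (SubgroupElt (wH e'))) VE; rewrite /= => ->.
exists V; first by apply: open_nbhs_nbhs; split=> //; apply/VP.
by move=> e' /VP.
Qed.

(* The character is [pred1 i], for an index i occurring in the expansion of a,
   if a is a non-trivial word in x; the constant -1 on x if a = 1; and the
   character trivial on x with value -1 at a if a is not in the span of x. *)
Lemma free_no_accumulation x a : free x -> ~ accumulation_point x a.
Proof.
move=> xfree xa.
have [[e ea]|/forallNP nxa] := pselect (exists e, word x e = a); last first.
  have yfree := free_cons G_boolean a x xfree nxa.
  (* In the extended sequence [a] has index 0 and [x n] has index [n.+1]. *)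
  have [V] := free_dot_near _ (pred1 0) (unit_exp 0) yfree.
  rewrite word_unit_exp dot_unit_exp /= => /xa/infinite_setN0[n /= Vxn] VP.
  by have := VP (unit_exp n.+1); rewrite word_unit_exp dot_unit_exp /= => /(_ Vxn).
have [ehas|enhas] := boolP (has id e); last first.
  have [V] := free_dot_near x xpredT e xfree.
  rewrite ea (dot_nhas _ _ enhas) => /xa/infinite_setN0[n /= Vxn] VP.
  by have := VP (unit_exp n); rewrite word_unit_exp dot_unit_exp /= => /(_ Vxn).
have [V] := free_dot_near x (pred1 (find id e)) e xfree.
(* Here [V] may contain [x n] for the single index [n = find id e], so it is finiteness that gives
   the contradiction. *)
rewrite ea dot_pred1 (nth_find false ehas) => /xa xV VP; apply: xV.
apply: (@sub_finite_set _ _ [set find id e]) => // n /= Vxn.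
by apply/eqP; have := VP (unit_exp n); rewrite word_unit_exp dot_unit_exp; apply.
Qed.

End FreeSequences.

(** * Neighbourhoods of the identity *)

Section Neighbourhoods.
Local Open Scope group_scope.
Variable G : topologicalGroupType.

(** Singletons of an injective sequence force the selection, and an accumulation point in a discrete
    space is a value taken infinitely often. *)
Lemma discrete_not_selectively_pseudocompact :
  infinite_set [set: G] -> open [set (1 : G)] -> ~ selectively_pseudocompact G.
Proof.
move=> Ginf open1 Gsp.
have nbhs_pt (g : G) : nbhs g [set g].
  have := @mulg_continuous G (g^-1, g) [set 1].
  rewrite /= mulVg => /(_ (open_nbhs_nbhs _))[]//.
  move=> [A B] /= [Ag Bg] AB; apply: filterS Bg => h Bh.
  have := AB (g^-1, h); rewrite /= => /(_ _)/(canRL (mulVKg g)).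
  by rewrite mulg1; apply; split=> //; exact: nbhs_singleton.
pose Gp : pointedType := HB.pack_for pointedType G (isPointed.Build G 1).
have /infiniteP/(@pcard_leP _ Gp)/injfunPex[g _ ginj] := Ginf.
have [n|x xg [a xa]] := Gsp (fun n => [set g n]).
  by split; [rewrite openE => _ -> ; exact: nbhs_pt|exists (g n)].
have /infinite_setN0[n0 /= xn0] := xa _ (nbhs_pt a).
apply: (xa _ (nbhs_pt a)); apply: (@sub_finite_set _ _ [set n0]) => // n /= xn.
by apply: ginj; rewrite ?inE// -[LHS]xg xn -xn0 xg.
Qed.

Lemma nbhs1_split : hausdorff_space G -> ~ open [set (1 : G)] ->
  forall V : set G, nbhs 1 V -> exists UW : set G * set G,
    [/\ open UW.1, UW.1 !=set0, nbhs 1 UW.2, UW.2 `<=` V &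
      forall u w, UW.1 u -> UW.2 w -> V (u * w) /\ u * w <> 1].
Proof.
move=> G_T2 nopen1 V V1.
have [g Vg g1] : exists2 g, V^° g & g <> 1.
  apply: contrapT => /forall2NP nV; apply: nopen1.
  rewrite openE => _ ->; apply: filterS (nbhs_interior V1) => g Vg.
  by have [|/contrapT] := nV g.
have gV : nbhs (g * 1) (V `&` ~` [set 1]).
  rewrite mulg1; apply: filterI => //.
  apply: open_nbhs_nbhs; split=> //; apply: closed_openC.
  by apply: accessible_closed_set1; exact: hausdorff_accessible.
have [[A B] /= [Ag B1] AB] := @mulg_continuous G (g, 1) _ gV.
exists (A^°, B `&` V); split=> //=.
- exact: open_interior.
- by exists g.
- exact: filterI.
- by move=> u w /interior_subset Au [Bw _]; exact: (AB (u, w)).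
Qed.

Lemma free_selection : hausdorff_space G -> ~ open [set (1 : G)] ->
  exists2 U : nat -> set G, (forall n, open (U n) /\ U n !=set0) &
    forall x, (forall n, U n (x n)) -> free x.
Proof.
move=> G_T2 nopen1.
have /choice [F FP] : forall V : set G, exists UW : set G * set G,
    nbhs 1 V -> [/\ open UW.1, UW.1 !=set0, nbhs 1 UW.2, UW.2 `<=` V &
      forall u w, UW.1 u -> UW.2 w -> V (u * w) /\ u * w <> 1].
  move=> V; have [/(nbhs1_split G_T2 nopen1)[UW]|] := pselect (nbhs 1 V).
    by exists UW.
  by exists (set0, set0).
pose V n := iter n (fun W => (F W).2) [set: G].
have V1 n : nbhs 1 (V n).
  by elim: n => [|n IH]; [exact: filterT|have [] := FP _ IH].
have Vsub n : V n.+1 `<=` V n by have [] := FP _ (V1 n).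
exists (fun n => (F (V n)).1) => [n|x xU]; first by have [] := FP _ (V1 n).
have UV n w : V n.+1 w -> V n (x n * w) /\ x n * w <> 1.
  by have [_ _ _ _] := FP _ (V1 n); apply.
have wordV e n : V n (word (fun i => x (n + i)%N) e).
  elim: e n => [|b e IH] n /=; first exact: nbhs_singleton.
  have := IH n.+1; rewrite addn0 (_ : _ \o S = fun i => x (n.+1 + i)%N).
    by case: b => [/UV[]|/Vsub]; rewrite ?expg1// expg0 mul1g.
  by apply/funext => i /=; rewrite addnS.
suff wordfree e n : word (fun i => x (n + i)%N) e = 1 -> ~~ has id e.
  by move=> e /(wordfree e 0).
elim: e n => [//|b e IH] n /=.
rewrite addn0 (_ : _ \o S = fun i => x (n.+1 + i)%N); last first.
  by apply/funext => i /=; rewrite addnS.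
case: b => /=; last by rewrite expg0 mul1g; exact: IH.
by rewrite expg1; have [] := UV _ _ (wordV e n.+1).
Qed.

End Neighbourhoods.

Theorem theorem4p1 (R : realType) (G : topologicalGroupType)
    (G_hausdorff : hausdorff_space G)
    (G_boolean : boolean_group G)
    (G_infinite : infinite_set [set: G])
    (G_bohr : forall H : groupClosed G,
      countable [set x : G | x \in H] -> finer_than_bohr R H) :
  ~ selectively_pseudocompact G.
Proof.
have [/discrete_not_selectively_pseudocompact|nopen1] :=
  pselect (open [set (1%g : G)]); first exact.
move=> Gsp; have [U U0 Ufree] := free_selection _ G_hausdorff nopen1.
have [x /Ufree xfree [a]] := Gsp U U0.
exact: free_no_accumulation G_boolean G_bohr _ _ xfree.
Qed.
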